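(* Suppose $d\ge2$, $D\ge101$ and $T\ge45(d-1)^2D$. Then for any algorithm $\mathfrak A$ there exists an MDP $M_\theta$ of the family below (with $\delta=1/D$) such that $L_\theta\le100/99$, $L_\varphi\le1+\log(D-1)$, and $\mathbb E[\mathrm{Regret}(M_\theta,\mathfrak A,x_0,T)]\ge\frac1{2025}d\sqrt{DT}$, where the expectation is over the randomness of $M_\theta$ and $\mathfrak A$.
   Context: Family $M_\theta$: two states $x_0,x_1$; actions $\mathcal A=\{-1,1\}^{d-1}$; rewards $r(x_0,a)=0$, $r(x_1,a)=1$. Parameters: $\delta=1/D$, $\Delta=(d-1)/(45\sqrt{(2/5)(T/\delta)\log2})$, $\bar\Delta=\log\frac{(1-\delta)(\delta+\Delta)}{\delta(1-\delta-\Delta)}$, $\alpha=\sqrt{\bar\Delta/((d-1)(1+\bar\Delta))}$, $\beta=\sqrt{1/(1+\bar\Delta)}$. Features: $\varphi(x_0,a,x_0)=(-\alpha a,\beta\log(\delta^{-1}-1))$, $\varphi(x_0,a,x_1)=\varphi(x_1,a,x_0)=(0,0)$, $\varphi(x_1,a,x_1)=(0,\beta\log(\delta^{-1}-1))$ in $\mathbb R^{d-1}\times\mathbb R$. For $\theta\in\{-\bar\Delta/(d-1),\bar\Delta/(d-1)\}^{d-1}$ the transition core is $\bar\theta=(\theta/\alpha,1/\beta)$ and $p(x_j\mid x_i,a)=\exp(\varphi(x_i,a,x_j)^\top\bar\theta)/\sum_{j'\in\{0,1\}}\exp(\varphi(x_i,a,x_{j'})^\top\bar\theta)$; thus $p(x_1\mid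 x_0,a)=1/(1+(\delta^{-1}-1)e^{-a^\top\theta})$ and $p(x_0\mid x_1,a)=\delta$. $L_\theta=\|\bar\theta\|_2$, $L_\varphi=\max\|\varphi\|_2$. With $s_1=x_0$ and $J^*(M_\theta)$ the optimal average reward, $\mathrm{Regret}(M_\theta,\mathfrak A,x_0,T)=TJ^*(M_\theta)-\sum_{t=1}^Tr(s_t,a_t)$. *)

(* Defs.v *)
From mathcomp Require Import all_boot all_order all_algebra.
From mathcomp Require Import all_classical all_reals all_analysis.
Set Implicit Arguments. Unset Strict Implicit. Unset Printing Implicit Defensive.
Import Order.TTheory GRing.Theory Num.Theory numFieldNormedType.Exports.
Local Open Scope ring_scope.

(* The hard-instance family M_theta.
   States: bool, with false = x_0 and true = x_1.
   Actions: A = {-1,1}^(d-1), encoded as sign vectors {ffun 'I_(d-1) -> bool}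
   (true |-> +1, false |-> -1).
   Parameters theta in {-Dbar/(d-1), Dbar/(d-1)}^(d-1): also encoded by sign vectors.
   Feature space R^(d-1) x R is 'rV[R]_(d-1) * R. *)
Section Family.
Variable R : realType.
Variables (d : nat) (D : R) (T : nat).

Definition state := bool.
Definition x0 : state := false.
Definition x1 : state := true.
Definition act := {ffun 'I_d.-1 -> bool}.
Definition sgnb (b : bool) : R := if b then 1 else -1.
Definition avec (a : act) : 'rV[R]_(d.-1) := \row_i sgnb (a i).

Definition feat := ('rV[R]_(d.-1) * R)%type.
Definition fdot (u v : feat) : R := \sum_i u.1 0 i * v.1 0 i + u.2 * v.2.
Definition fnorm (u : feat) : R := Num.sqrt (fdot u u).

Definition delta : R := D^-1.
Definition dm1 : R := d%:R - 1.
Definition Delta : R := dm1 / (45 * Num.sqrt (2/5 * (T%:R / delta) * ln 2)).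
Definition Deltabar : R :=
  ln ((1 - delta) * (delta + Delta) / (delta * (1 - delta - Delta))).
Definition alpha : R := Num.sqrt (Deltabar / (dm1 * (1 + Deltabar))).
Definition beta : R := Num.sqrt (1 / (1 + Deltabar)).

Definition theta (th : act) : 'rV[R]_(d.-1) := \row_i (sgnb (th i) * (Deltabar / dm1)).
Definition thetabar (th : act) : feat := (alpha^-1 *: theta th, beta^-1).

Definition phi (x : state) (a : act) (y : state) : feat :=
  match x, y with
  | false, false => (- (alpha *: avec a), beta * ln (delta^-1 - 1))
  | true, true => (0, beta * ln (delta^-1 - 1))
  | _, _ => (0, 0)
  end.

Definition trans (th : act) (x : state) (a : act) (y : state) : R :=
  expR (fdot (phi x a y) (thetabar th)) /
  \sum_(y' : state) expR (fdot (phi x a y') (thetabar th)).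

Definition reward (x : state) (a : act) : R := if x then 1 else 0.

Definition Ltheta (th : act) : R := fnorm (thetabar th).
Definition Lphi : R :=
  \big[Num.max/0]_(x : state) \big[Num.max/0]_(a : act) \big[Num.max/0]_(y : state)
     fnorm (phi x a y).

(* n-step optimal value (value iteration); rewards are >= 0 so 0 is a
   neutral element for the max over the (nonempty) action set. *)
Fixpoint vstar (th : act) (n : nat) (x : state) : R :=
  match n with
  | 0 => 0
  | n.+1 => \big[Num.max/0]_(a : act)
              (reward x a + \sum_(y : state) trans th x a y * vstar th n y)
  end.

Definition Jstar (th : act) : R := limn ((fun n : nat => vstar th n x0 / n%:R) : R^nat).

(* A (randomized, history-dependent) algorithm: given the past history
   [(s_1,a_1);...;(s_{t-1},a_{t-1})] and the current state s_t, a
   probability distribution over actions. *)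
Definition algorithm := seq (state * act) -> state -> act -> R.
Definition is_algorithm (alg : algorithm) : Prop :=
  forall h s, (forall a, 0 <= alg h s a) /\ \sum_(a : act) alg h s a = 1.

Fixpoint exp_reward (th : act) (alg : algorithm) (h : seq (state * act))
    (s : state) (n : nat) : R :=
  match n with
  | 0 => 0
  | n.+1 => \sum_(a : act) alg h s a *
      (reward s a + \sum_(s' : state) trans th s a s' * exp_reward th alg (rcons h (s, a)) s' n)
  end.

Definition expected_regret (th : act) (alg : algorithm) : R :=
  T%:R * Jstar th - exp_reward th alg [::] x0 T.
End Family.

(* Main.v *)
Require Import Defs.
From mathcomp Require Import all_boot all_order all_algebra.
From mathcomp Require Import all_classical all_reals all_analysis.
From mathcomp Require Import ring lra.
Set Implicit Arguments. Unset Strict Implicit. Unset Printing Implicit Defensive.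
Import Order.TTheory GRing.Theory Num.Theory numFieldNormedType.Exports.
Local Open Scope ring_scope.

(* Let J be the optimal gain under theta and w = 1 / (2 delta + Delta) the bias of x_1
   relative to x_0. Telescoping the bias along a trajectory bounds the regret below by
   w times the sum, over the visits to x_0, of delta + Delta - p(x_1 | x_0, a); as the
   sigmoid is nearly linear near 0, this is at least w Delta / (d - 1) times the expected
   number of wrong action coordinates at x_0. The same telescoping shows that x_0 is visited
   at least T (1 - J) times in expectation. Flipping one coordinate of theta changes the
   law of the whole trajectory by a small amount in chi-square divergence, so an
   algorithm cannot be right on that coordinate under both parameters: the two expected
   numbers of errors add up to a constant fraction of T. Averaging over all theta gives
   a parameter with large regret. *)

(** * Expected total reward of an algorithm in a finite MDP *)

Section Value.
Variables (R : realType) (S A : finType).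
Implicit Types (p q : S -> A -> S -> R) (g : S -> A -> R).
Implicit Types (h : seq (S * A)) (s : S) (n : nat).

Definition stochastic p : Prop :=
  forall s a, (forall s', 0 <= p s a s') /\ \sum_s' p s a s' = 1.

Variable alg : seq (S * A) -> S -> A -> R.
Hypothesis alg_ge0 : forall h s a, 0 <= alg h s a.
Hypothesis alg_sum1 : forall h s, \sum_a alg h s a = 1.

(** Kernel and reward are arbitrary, so that visit and error counts are values just like the reward
    itself. *)
Fixpoint value p g h s n : R :=
  match n with
  | 0 => 0
  | n'.+1 => \sum_a alg h s a *
      (g s a + \sum_s' p s a s' * value p g (rcons h (s, a)) s' n')
  end.

Lemma value_sub p g1 g2 c h s n :
  value p (fun s a => g1 s a + c * g2 s a) h s n =
  value p g1 h s n + c * value p g2 h s n.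
Proof.
elim: n h s => [|n IHn] h s /=; first by rewrite mulr0 addr0.
rewrite mulr_sumr -big_split /=; apply: eq_bigr => a _.
under eq_bigr do rewrite IHn mulrDr mulrCA.
by rewrite big_split /= -mulr_sumr; ring.
Qed.

Lemma eq_value p g1 g2 h s n : g1 =2 g2 -> value p g1 h s n = value p g2 h s n.
Proof.
move=> eqg; elim: n h s => //= n IHn h s.
by apply: eq_bigr => a _; rewrite eqg; under eq_bigr do rewrite IHn.
Qed.

Lemma value_sum p (I : finType) (g : I -> S -> A -> R) h s n :
  value p (fun s a => \sum_i g i s a) h s n = \sum_i value p (g i) h s n.
Proof.
elim: n h s => [|n IHn] h s /=; first by rewrite big1.
rewrite exchange_big /=; apply: eq_bigr => a _.
rewrite -mulr_sumr big_split /= exchange_big /=.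
by congr (_ * (_ + _)); apply: eq_bigr => s' _; rewrite IHn mulr_sumr.
Qed.

Lemma value_cst p c h s n : stochastic p ->
  value p (fun _ _ => c) h s n = n%:R * c.
Proof.
move=> pP; elim: n h s => [|n IHn] h s /=; first by rewrite mul0r.
under eq_bigr => a _.
  under eq_bigr do rewrite IHn.
  rewrite -mulr_suml (pP s a).2 mul1r; over.
by rewrite -mulr_suml alg_sum1 -natr1; ring.
Qed.

(** [J] acts as a gain and [b] as a bias: the inequality telescopes along the trajectory, and the
    potential left at the horizon is dropped because it is nonnegative. *)
Lemma value_potential p g (b : S -> R) J h s n : stochastic p ->
    (forall s, 0 <= b s) ->
    (forall s a, g s a + \sum_s' p s a s' * b s' <= J + b s) ->
  value p g h s n <= n%:R * J + b s.
Proof.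
move=> pP b_ge0 gJ; elim: n h s => [|n IHn] h s /=; first by rewrite mul0r add0r.
rewrite -[leRHS]mul1r -[X in X * _](alg_sum1 h s) mulr_suml ler_sum // => a _.
rewrite ler_wpM2l //.
have : \sum_s' p s a s' * value p g (rcons h (s, a)) s' n <=
       \sum_s' p s a s' * (n%:R * J + b s').
  by apply: ler_sum => s' _; rewrite ler_wpM2l ?(pP s a).1.
under [in leRHS]eq_bigr do rewrite mulrDr.
rewrite big_split /= -mulr_suml (pP s a).2 mul1r. rewrite -natr1.
by have := gJ s a; lra.
Qed.

(* With r = x / y this is (x - y) <= y * (l (r - 1)^2 / 2 + 1 / (2 l)), from AM-GM. *)
Lemma sub_le_sqr_div (l x y : R) : 0 < l -> 0 < y ->
  x - y <= l / 2 * (x ^+ 2 / y - 2 * x + y) + y / (2 * l).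
Proof.
move=> l0 y0; rewrite -subr_ge0.
have -> : l / 2 * (x ^+ 2 / y - 2 * x + y) + y / (2 * l) - (x - y) =
    (l * (x - y) - y) ^+ 2 / (2 * l * y).
  by field; rewrite !lt0r_neq0.
by rewrite divr_ge0 ?sqr_ge0 // !mulr_ge0 // ltW.
Qed.

(* The weights x and y stand for the likelihoods of the history under p and q:
   they make the chi-square bound for whole trajectories provable by induction. *)
Lemma value_chi2_weighted p q g (C l x y : R) h s n :
    stochastic p -> stochastic q -> (forall s a s', 0 < q s a s') ->
    (forall s a, 0 <= g s a <= 1) -> 0 < l -> 1 <= C ->
    (forall s a, \sum_s' p s a s' ^+ 2 / q s a s' <= C) -> 0 <= x -> 0 < y ->
  x * value p g h s n - y * value q g h s n <=
  n%:R * (l / 2 * (x ^+ 2 / y * C ^+ n - 2 * x + y) + y / (2 * l)).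
Proof.
move=> pP qP q_gt0 g01 l0 C1 pqC.
elim: n h s x y => [|n IHn] h s x y x0 y0 /=; first by rewrite !mulr0 mul0r subrr.
rewrite !mulr_sumr -sumrB -[leRHS]mul1r -[X in X * _](alg_sum1 h s) mulr_suml.
apply: ler_sum => a _; rewrite !(mulrCA _ (alg _ _ _)) -mulrBr ler_wpM2l //.
set Vp := fun s' => value p g (rcons h (s, a)) s' n.
set Vq := fun s' => value q g (rcons h (s, a)) s' n.
have l2_ge0 : 0 <= l / 2 by rewrite divr_ge0 ?ltW.
have xy0 : 0 <= x ^+ 2 / y by rewrite divr_ge0 ?sqr_ge0 ?ltW.
have le_xy : (x - y) * g s a <=
    l / 2 * (x ^+ 2 / y * C ^+ n.+1 - 2 * x + y) + y / (2 * l).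
  have B_ge0 : 0 <= l / 2 * (x ^+ 2 / y - 2 * x + y) + y / (2 * l).
    have -> : x ^+ 2 / y - 2 * x + y = (x - y) ^+ 2 / y.
      by field; rewrite lt0r_neq0.
    have ly_ge0 : 0 <= y / (2 * l) by rewrite divr_ge0 ?mulr_ge0 // ltW.
    by rewrite addr_ge0 // mulr_ge0 // divr_ge0 ?sqr_ge0 // ltW.
  apply: (@le_trans _ _ (l / 2 * (x ^+ 2 / y - 2 * x + y) + y / (2 * l))).
    have [xy|/ltW xy] := leP 0 (x - y); last first.
      by apply: le_trans B_ge0; rewrite mulr_le0_ge0 //; case/andP: (g01 s a).
    apply: le_trans (sub_le_sqr_div x l0 y0).
    by rewrite ler_piMr //; case/andP: (g01 s a).
  rewrite lerD2r ler_wpM2l // !lerD2r ler_peMr //.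
  by rewrite exprn_ege1.
(* The induction hypothesis is taken at the weights [x * p s a s'] and [y * q s a s']. Summed over
   the next state, the quadratic term gains a factor at most [C] and the linear terms keep their
   totals. *)
have le_sum : x * \sum_s' p s a s' * Vp s' - y * \sum_s' q s a s' * Vq s' <=
    n%:R * (l / 2 * (x ^+ 2 / y * C ^+ n.+1 - 2 * x + y) + y / (2 * l)).
  rewrite !mulr_sumr -sumrB.
  apply: (@le_trans _ _ (\sum_s' n%:R * (l / 2 * (x ^+ 2 / y * C ^+ n *
      (p s a s' ^+ 2 / q s a s') - 2 * x * p s a s' + y * q s a s')
      + y / (2 * l) * q s a s'))).
    apply: ler_sum => s' _; rewrite !mulrA.
    apply: le_trans (IHn (rcons h (s, a)) s' (x * p s a s') (y * q s a s') _ _) _.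
    - by rewrite mulr_ge0 ?(pP s a).1.
    - by rewrite mulr_gt0.
    rewrite le_eqVlt; apply/orP; left; apply/eqP.
    by field; rewrite !lt0r_neq0 ?q_gt0.
  rewrite -mulr_sumr ler_wpM2l // big_split /= -!mulr_sumr (qP s a).2 mulr1.
  rewrite lerD2r ler_wpM2l // !big_split /= sumrN -!mulr_sumr.
  rewrite (pP s a).2 (qP s a).2 !mulr1. rewrite !lerD2r (exprSr C) mulrA ler_wpM2l //.
  by rewrite mulr_ge0 ?exprn_ge0 //; lra.
rewrite -natr1 mulrDl mul1r; move: le_xy le_sum; rewrite /Vp /Vq; lra.
Qed.

(** [C ^+ n - 1] bounds the chi-square divergence between the two trajectory laws. The free [l]
    stands in for Cauchy-Schwarz: at the best [l] the bracket is the square root of [C ^+ n - 1]. *)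
Lemma value_chi2 p q g (C l : R) h s n :
    stochastic p -> stochastic q -> (forall s a s', 0 < q s a s') ->
    (forall s a, 0 <= g s a <= 1) -> 0 < l -> 1 <= C ->
    (forall s a, \sum_s' p s a s' ^+ 2 / q s a s' <= C) ->
  value p g h s n - value q g h s n <= n%:R * (l / 2 * (C ^+ n - 1) + 1 / (2 * l)).
Proof.
move=> pP qP q_gt0 g01 l0 C1 pqC.
have := value_chi2_weighted h s n pP qP q_gt0 g01 l0 C1 pqC ler01 ltr01.
rewrite !mul1r expr1n invr1 !mul1r mulr1.
by have -> : C ^+ n - 2 + 1 = C ^+ n - 1 by ring.
Qed.

End Value.

(** From [exp(-1/2) >= 1 - 1/2]. With [ln2_le1] it removes [ln 2] from the estimates on [Delta], in
    either direction. *)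
Lemma ln2_ge_half (R : realType) : 1 / 2 <= ln 2 :> R.
Proof.
rewrite -(@expRK R (1 / 2)) ler_ln ?posrE ?expR_gt0 //.
have := expR_ge1Dx (- (1 / 2 : R)); rewrite expRN => e1.
have e0 := expR_gt0 (1 / 2 : R).
have : expR (1 / 2) * (1 + - (1 / 2)) <= expR (1 / 2) * (expR (1 / 2))^-1 :> R.
  by rewrite ler_wpM2l // ltW.
by rewrite divff ?lt0r_neq0 //; lra.
Qed.

Lemma ln2_le1 (R : realType) : ln 2 <= 1 :> R.
Proof. by have := @le_ln1Dx R 1 ltac:(lra); have -> : 1 + 1 = 2 :> R by ring. Qed.

(** * The sigmoid giving the transition probability out of x_0 *)

Section Sigmoid.
Variables (R : realType) (D : R).
Hypothesis D_gt1 : 1 < D.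

(** This is p(x_1 | x_0, a) as a function of [x = a^T theta], with [D - 1] for [delta^-1 - 1]. *)
Definition sigmoid (x : R) : R := (1 + (D - 1) * expR (- x))^-1.

Lemma sigmoid_denom_gt0 x : 0 < 1 + (D - 1) * expR (- x).
Proof. by rewrite addr_gt0 // mulr_gt0 ?expR_gt0 // subr_gt0. Qed.

Lemma sigmoid_gt0 x : 0 < sigmoid x.
Proof. by rewrite invr_gt0 sigmoid_denom_gt0. Qed.

Lemma onem_sigmoid x : 1 - sigmoid x = (D - 1) * expR (- x) * sigmoid x.
Proof. by rewrite /sigmoid; field; rewrite lt0r_neq0 ?sigmoid_denom_gt0. Qed.

Lemma sigmoid_lt1 x : sigmoid x < 1.
Proof.
by rewrite -subr_gt0 onem_sigmoid !mulr_gt0 ?expR_gt0 ?sigmoid_gt0 // subr_gt0.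
Qed.

(** This factorization reduces the one-sided estimates below to
    [z / (1 + z) <= 1 - exp(-z) <= z]. *)
Lemma sigmoidB x y :
  sigmoid x - sigmoid y = sigmoid x * (1 - sigmoid y) * (1 - expR (- (x - y))).
Proof.
have -> : - (x - y) = - x - (- y) by ring.
have F0 := expR_gt0 (- y); have E1 := sigmoid_denom_gt0 x.
have F1 := sigmoid_denom_gt0 y; rewrite onem_sigmoid /sigmoid expRB.
by field; rewrite !lt0r_neq0.
Qed.

Lemma ler_sigmoid x y : x <= y -> sigmoid x <= sigmoid y.
Proof.
move=> xy; rewrite -subr_ge0 sigmoidB mulr_ge0 //.
  by rewrite mulr_ge0 ?subr_ge0 // ltW ?sigmoid_gt0 ?sigmoid_lt1.
by rewrite subr_ge0 -[leRHS]expR0 ler_expR; lra.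
Qed.

Lemma sigmoidB_le x y : sigmoid x - sigmoid y <= sigmoid x * (1 - sigmoid y) * (x - y).
Proof.
rewrite sigmoidB ler_wpM2l //.
  by rewrite mulr_ge0 ?subr_ge0 // ltW ?sigmoid_gt0 ?sigmoid_lt1.
by have := expR_ge1Dx (- (x - y)); lra.
Qed.

Lemma sigmoidB_ge x y : y <= x ->
  sigmoid x * (1 - sigmoid y) * ((x - y) / (1 + (x - y))) <= sigmoid x - sigmoid y.
Proof.
move=> yx; have z0 : 0 < 1 + (x - y) by lra.
rewrite sigmoidB ler_wpM2l //.
  by rewrite mulr_ge0 ?subr_ge0 // ltW ?sigmoid_gt0 ?sigmoid_lt1.
have : expR (- (x - y)) <= (1 + (x - y))^-1.
  by rewrite expRN lef_pV2 ?posrE ?expR_gt0 // expR_ge1Dx.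
suff e : (1 + (x - y))^-1 = 1 - (x - y) / (1 + (x - y)) by move: e; lra.
by field; rewrite lt0r_neq0.
Qed.

Lemma sigmoid0 : sigmoid 0 = D^-1.
Proof. by rewrite /sigmoid oppr0 expR0 mulr1 addrC subrK. Qed.

End Sigmoid.

(** Both sides are compared with [expR c]. This keeps the chi-square divergence bounded over the
    whole horizon when each step contributes [c / n]. *)
Lemma compound_le (R : realType) (n : nat) (c : R) : (0 < n)%N -> 0 <= c < 1 ->
  (1 + c / n%:R) ^+ n <= (1 - c)^-1.
Proof.
move=> n_gt0 /andP[c_ge0 c_lt1].
have le_exp : (1 + c / n%:R) ^+ n <= expR c.
  have -> : expR c = expR (c / n%:R) ^+ n.
    by rewrite -expRM_natl mulrC divfK // pnatr_eq0 -lt0n.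
  by rewrite lerXn2r ?nnegrE ?expR_ge0 ?expR_ge1Dx // addr_ge0 // divr_ge0.
apply: le_trans le_exp _; rewrite -[expR c]invrK -expRN lef_pV2 ?posrE ?expR_gt0 //.
  exact: expR_ge1Dx.
by rewrite subr_gt0.
Qed.

Lemma exists_ge_mean (R : realType) (I : finType) (i0 : I) (F : I -> R) (c : R) :
  #|I|%:R * c <= \sum_i F i -> exists i, c <= F i.
Proof.
move=> le_sum; apply: contrapT => /forallNP noi.
suff : \sum_i F i < \sum_(i : I) c.
  by rewrite sumr_const -mulr_natl ltNge le_sum.
(* The index [i0] is what makes the inequality between the sums strict. *)
apply: ltr_sum => [|i _]; first by apply/hasP; exists i0; rewrite ?mem_index_enum.
by rewrite ltNge; apply/negP.
Qed.

(** * The hard instances *)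

Section HardInstance.
Variables (R : realType) (d : nat) (D : R) (T : nat).
Hypothesis d_ge2 : (2 <= d)%N.
Hypothesis D_ge : 101 <= D.
Hypothesis T_ge : 45 * (d%:R - 1) ^+ 2 * D <= T%:R.

Local Notation k := (dm1 R d).
Local Notation dlt := (delta D).
Local Notation Dlt := (Delta d D T).
Local Notation Dbar := (Deltabar d D T).

Let D_gt1 : 1 < D. Proof. by move: D_ge; lra. Qed.
Let D_gt0 : 0 < D. Proof. by move: D_ge; lra. Qed.

(** * Sizes of [delta], [Delta] and [Deltabar] *)

Lemma dm1_ge1 : 1 <= k.
Proof. by rewrite /dm1; have : 2 <= d%:R :> R; [rewrite ler_nat | lra]. Qed.

Lemma dm1_gt0 : 0 < k. Proof. by apply: lt_le_trans dm1_ge1. Qed.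

Lemma dm1E : (d.-1)%:R = k.
Proof. by rewrite /dm1 -subn1 natrB // (leq_trans _ d_ge2). Qed.

Lemma horizon_ge : 45 * k ^+ 2 * D <= T%:R.
Proof. exact: T_ge. Qed.

Lemma horizon_gt0 : 0 < T%:R :> R.
Proof.
by apply: lt_le_trans horizon_ge; rewrite !mulr_gt0 ?exprn_gt0 ?dm1_gt0.
Qed.

Lemma delta_gt0 : 0 < dlt. Proof. by rewrite invr_gt0. Qed.

Lemma delta_le : dlt <= 1 / 101.
Proof. by rewrite /delta div1r lef_pV2 ?posrE. Qed.

Lemma deltaD : dlt * D = 1. Proof. by rewrite mulVf ?lt0r_neq0. Qed.

Let radicand_gt0 : 0 < 2 / 5 * (T%:R / dlt) * ln 2 :> R.
Proof.
have := ln2_ge_half R; have := horizon_gt0; rewrite /delta invrK => T0 l2.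
by rewrite !mulr_gt0 ?invr_gt0 //; lra.
Qed.

Lemma Delta_gt0 : 0 < Dlt.
Proof.
by rewrite divr_gt0 ?mulr_gt0 ?sqrtr_gt0 ?dm1_gt0.
Qed.

Lemma Delta_sqr : Dlt ^+ 2 * (810 * (T%:R * D) * ln 2) = k ^+ 2.
Proof.
(* The constant is [45^2 * 2/5 = 810]. *)
have -> : 810 * (T%:R * D) * ln 2 = (45 * Num.sqrt (2/5 * (T%:R / dlt) * ln 2)) ^+ 2.
  by rewrite exprMn sqr_sqrtr ?ltW // /delta invrK; field.
by rewrite -exprMn /Delta divfK // mulf_neq0 ?lt0r_neq0 ?sqrtr_gt0.
Qed.

Lemma Delta_sqr_le : Dlt ^+ 2 * (405 * (T%:R * D)) <= k ^+ 2.
Proof.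
have uv_ge0 : 0 <= Dlt ^+ 2 * (T%:R * D).
  by rewrite mulr_ge0 ?sqr_ge0 // mulr_ge0 ?ltW ?horizon_gt0.
have L_ge0 : 0 <= ln 2 - 1 / 2 :> R by rewrite subr_ge0 ln2_ge_half.
have := mulr_ge0 uv_ge0 L_ge0; have := Delta_sqr; lra.
Qed.

(** The lower bound on the horizon enters here, with [405 * 45 = 135^2]. *)
Lemma Delta_le : Dlt <= dlt / 135.
Proof.
have k2 : 0 < k ^+ 2 by rewrite exprn_gt0 ?dm1_gt0.
have uD_ge0 : 0 <= Dlt ^+ 2 * D by rewrite mulr_ge0 ?sqr_ge0 ?ltW.
have le_u := ler_wpM2l uD_ge0 horizon_ge.
have : (Dlt * D) ^+ 2 * k ^+ 2 <= (135^-1) ^+ 2 * k ^+ 2.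
  by move: Delta_sqr_le le_u; lra.
have e0 : 0 <= Dlt * D by rewrite mulr_ge0 // ltW // Delta_gt0.
rewrite ler_pM2r // ler_sqr ?nnegrE // => le1.
have := ler_wpM2l (ltW delta_gt0) le1.
by rewrite mulrCA deltaD mulr1.
Qed.

(** The converse estimate, from [2/5 * ln 2 <= 1]; it trades [Delta] for the square root in the
    final bound. *)
Lemma dm1_le_Delta : k <= 45 * Dlt * Num.sqrt (D * T%:R).
Proof.
have s0 : 0 < 45 * Num.sqrt (2/5 * (T%:R / dlt) * ln 2) by rewrite mulr_gt0 ?sqrtr_gt0.
have kE : k = Dlt * (45 * Num.sqrt (2/5 * (T%:R / dlt) * ln 2)) by rewrite divfK ?lt0r_neq0.
rewrite {}kE [leRHS]mulrAC [leRHS]mulrC ler_wpM2l ?(ltW Delta_gt0) // ler_wpM2l //.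
rewrite ler_sqrt; last by rewrite mulr_ge0 ?ltW ?horizon_gt0.
rewrite /delta invrK [D * _]mulrC.
have TD0 : 0 <= T%:R * D by rewrite mulr_ge0 ?ltW ?horizon_gt0.
have L_ge0 : 0 <= 1 - ln 2 :> R by rewrite subr_ge0 ln2_le1.
by have := mulr_ge0 TD0 L_ge0; lra.
Qed.

Lemma delta_Delta_le : dlt + Dlt <= 2 / 101 * (69 / 135).
Proof. by have := Delta_le; have := delta_le; lra. Qed.

(** Numerator and denominator of the odds ratio differ by exactly [Delta]. *)
Lemma expR_Deltabar : expR Dbar = 1 + Dlt / (dlt * (1 - dlt - Dlt)).
Proof.
have d0 := delta_gt0; have D0 := Delta_gt0; have dD := delta_Delta_le.
have r0 : 0 < 1 - dlt - Dlt by lra.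
rewrite /Deltabar lnK; first by field; rewrite !lt0r_neq0.
by rewrite posrE divr_gt0 ?mulr_gt0 //; lra.
Qed.

Lemma Deltabar_gt0 : 0 < Dbar.
Proof.
have d0 := delta_gt0; have D0 := Delta_gt0; have dD := delta_Delta_le.
have r0 : 0 < 1 - dlt - Dlt by lra.
by rewrite -ltr_expR expR0 expR_Deltabar ltrDl divr_gt0 // mulr_gt0.
Qed.

Lemma delta_Deltabar_le : dlt * Dbar <= 103 / 100 * Dlt.
Proof.
have d0 := delta_gt0; have D0 := Delta_gt0; have dD := delta_Delta_le.
have r0 : 0 < 1 - dlt - Dlt by lra.
have : Dbar <= Dlt / (dlt * (1 - dlt - Dlt)).
  by have := expR_ge1Dx Dbar; rewrite expR_Deltabar; lra.
move=> /(ler_wpM2l (ltW d0)) /le_trans; apply.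
have -> : dlt * (Dlt / (dlt * (1 - dlt - Dlt))) = Dlt / (1 - dlt - Dlt).
  by field; rewrite !lt0r_neq0.
by rewrite ler_pdivrMr //; nra.
Qed.

Lemma Deltabar_le : Dbar <= 1 / 99.
Proof.
rewrite -(ler_pM2l delta_gt0); apply: le_trans delta_Deltabar_le _.
by have := Delta_le; have := delta_gt0; lra.
Qed.

(** [Deltabar] is the log odds ratio of [delta + Delta] against [delta], so an action agreeing with
    theta everywhere moves to x_1 with probability [delta + Delta]. *)
Lemma sigmoid_Deltabar : sigmoid D Dbar = dlt + Dlt.
Proof.
have d0 := delta_gt0; have D0 := Delta_gt0; have dD := delta_Delta_le.
have r0 : 0 < 1 - dlt - Dlt by lra.
have d1 : 0 < 1 - dlt by lra.
have dD0 : 0 < dlt + Dlt by lra.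
rewrite /sigmoid expRN /Deltabar lnK; last by rewrite posrE divr_gt0 ?mulr_gt0.
have -> : D - 1 = dlt^-1 - 1 by rewrite /delta invrK.
rewrite -[RHS]invrK; congr (_^-1).
by field; rewrite !lt0r_neq0.
Qed.

(** * Scores of actions and transition probabilities *)

Definition mismatch (th a : act d) : R := \sum_i (a i != th i)%:R.

Definition score (th a : act d) : R := \sum_i avec R a 0 i * theta D T th 0 i.

Lemma mismatch_ge0 th a : 0 <= mismatch th a.
Proof. by rewrite sumr_ge0. Qed.

Lemma mismatch_le th a : mismatch th a <= k.
Proof.
rewrite -dm1E -[X in _ <= X%:R]card_ord -sum1_card natr_sum ler_sum // => i _.
by rewrite ler_nat leq_b1.
Qed.

Lemma scoreE th a : score th a = Dbar - 2 * Dbar / k * mismatch th a.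
Proof.
have k0 := dm1_gt0; rewrite /score /mismatch.
transitivity (\sum_(i < d.-1) (Dbar / k - 2 * Dbar / k * (a i != th i)%:R)).
  apply: eq_bigr => i _; rewrite !mxE /sgnb.
  by case: (a i); case: (th i) => /=; field; rewrite lt0r_neq0.
rewrite sumrB -[X in _ - X]mulr_sumr; congr (_ - _).
by rewrite sumr_const card_ord -mulr_natr dm1E divfK ?lt0r_neq0.
Qed.

Lemma score_le th a : score th a <= Dbar.
Proof.
rewrite scoreE gerBl mulr_ge0 ?mismatch_ge0 // divr_ge0 ?ltW ?dm1_gt0 //.
by rewrite mulr_gt0 ?Deltabar_gt0.
Qed.

Lemma score_ge th a : - Dbar <= score th a.
Proof.
rewrite scoreE.
have c0 : 0 <= 2 * Dbar / k by rewrite divr_ge0 ?mulr_ge0 // ltW ?Deltabar_gt0 ?dm1_gt0.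
have := ler_wpM2l c0 (mismatch_le th a).
by rewrite divfK ?lt0r_neq0 ?dm1_gt0 //; lra.
Qed.

Let onepDbar_gt0 : 0 < 1 + Dbar. Proof. by rewrite addr_gt0 ?Deltabar_gt0. Qed.

Lemma alpha_gt0 : 0 < alpha d D T.
Proof.
by rewrite sqrtr_gt0 divr_gt0 ?Deltabar_gt0 // mulr_gt0 ?dm1_gt0.
Qed.

Lemma beta_gt0 : 0 < beta d D T.
Proof. by rewrite sqrtr_gt0 divr_gt0. Qed.

Lemma alpha_sqr : alpha d D T ^+ 2 = Dbar / (k * (1 + Dbar)).
Proof.
rewrite sqr_sqrtr // divr_ge0 ?(ltW Deltabar_gt0) // mulr_ge0 //; first exact: ltW dm1_gt0.
exact: ltW onepDbar_gt0.
Qed.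

Lemma beta_sqr : beta d D T ^+ 2 = 1 / (1 + Dbar).
Proof. by rewrite sqr_sqrtr // divr_ge0 // ltW. Qed.

Lemma fdot0l (v : feat R d) : fdot (0, 0) v = 0.
Proof. by rewrite /fdot /= mul0r addr0 big1 // => i _; rewrite mxE mul0r. Qed.

(** The factors [alpha] and [beta] of the features cancel against those of the core. *)
Lemma fdot_phi00 (th a : act d) :
  fdot (phi D T false a false) (thetabar D T th) = ln (D - 1) - score th a.
Proof.
rewrite /fdot /= /delta invrK addrC; congr (_ + _).
  by rewrite mulrAC divff ?mul1r // lt0r_neq0 ?beta_gt0.
rewrite -sumrN; apply: eq_bigr => i _; rewrite !mxE; field.
by rewrite !lt0r_neq0 ?alpha_gt0 ?dm1_gt0.
Qed.

Lemma fdot_phi11 (th a : act d) :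
  fdot (phi D T true a true) (thetabar D T th) = ln (D - 1).
Proof.
rewrite /fdot /= /delta invrK big1 ?add0r; last by move=> i _; rewrite mxE mul0r.
by rewrite mulrAC divff ?mul1r // lt0r_neq0 ?beta_gt0.
Qed.

Lemma transE th x a y : trans D T th x a y =
  match x, y with
  | false, false => 1 - sigmoid D (score th a)
  | false, true => sigmoid D (score th a)
  | true, false => dlt
  | true, true => 1 - dlt
  end.
Proof.
have lnD : expR (ln (D - 1)) = D - 1 by rewrite lnK // posrE subr_gt0.
have e0 := sigmoid_denom_gt0 D_gt1 (score th a).
have f01 : fdot (phi D T false a true) (thetabar D T th) = 0 by exact: fdot0l.
have f10 : fdot (phi D T true a false) (thetabar D T th) = 0 by exact: fdot0l.
rewrite /trans big_bool; case: x y => [] [].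
all: rewrite ?fdot_phi11 ?fdot_phi00 ?f01 ?f10 /= ?expR0 ?expRD ?lnD /delta.
- by field; rewrite lt0r_neq0.
- by field; rewrite lt0r_neq0.
- by rewrite /sigmoid div1r.
- by rewrite /sigmoid; field; rewrite lt0r_neq0.
Qed.

(* The optimal gain is J, and the bias of x_1 relative to x_0 is bw. *)
Local Notation bw := ((2 * dlt + Dlt)^-1).
Local Notation J := ((dlt + Dlt) * bw).

Definition bias (x : state) : R := if x then bw else 0.

Lemma bw_gt0 : 0 < bw.
Proof. by rewrite invr_gt0; have := delta_gt0; have := Delta_gt0; lra. Qed.

Lemma bias_ge0 x : 0 <= bias x.
Proof. by case: x => //=; rewrite ltW ?bw_gt0. Qed.

Lemma gain_ge0 : 0 <= J.
Proof.
by rewrite mulr_ge0 ?ltW ?bw_gt0 //; have := delta_gt0; have := Delta_gt0; lra.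
Qed.

Lemma bwE : 1 - dlt * bw = J.
Proof.
have d0 := delta_gt0; have D0 := Delta_gt0.
by field; rewrite lt0r_neq0 //; lra.
Qed.

(** By [bwE] the right side is [1 - J], a lower bound on the expected fraction of steps spent at
    x_0. *)
Lemma bw_ge : 100 / 201 <= dlt * bw.
Proof.
have d0 := delta_gt0; have D0 := Delta_gt0; have dD := Delta_le.
by rewrite ler_pdivlMr; lra.
Qed.

Lemma stochastic_trans (th : act d) : stochastic (trans D T th).
Proof.
have d0 := delta_gt0; have d1 := delta_le.
move=> s a; split=> [s'|]; last first.
  rewrite big_bool !transE; case: s => /=; ring.
have q0 := sigmoid_gt0 D_gt1 (score th a); have q1 := sigmoid_lt1 D_gt1 (score th a).
rewrite transE; case: s; case: s' => /=; lra.
Qed.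

Lemma trans_gt0 (th : act d) s a s' : 0 < trans D T th s a s'.
Proof.
have d0 := delta_gt0; have d1 := delta_le.
have q0 := sigmoid_gt0 D_gt1 (score th a); have q1 := sigmoid_lt1 D_gt1 (score th a).
rewrite transE; case: s; case: s' => /=; lra.
Qed.

(** An all-wrong action has score [- Dbar], so each wrong coordinate costs about [2 * Dlt / k];
    claiming half of this leaves a factor 2 to absorb the curvature of the sigmoid. *)
Lemma mismatch_gap (th a : act d) :
  Dlt / k * mismatch th a <= dlt + Dlt - sigmoid D (score th a).
Proof.
have d0 := delta_gt0; have D0 := Delta_gt0; have dD := delta_Delta_le.
have k0 := dm1_gt0; have b0 := Deltabar_gt0; have b1 := Deltabar_le.
have q1 : sigmoid D (score th a) <= dlt + Dlt.
  by rewrite -sigmoid_Deltabar; exact: ler_sigmoid (score_le _ _).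
(* The sigmoid rises by [Dlt] between 0 and [Dbar], with slope at most [dlt + Dlt]. *)
have e0 : Dlt <= (dlt + Dlt) * Dbar.
  have := sigmoidB_le D_gt1 Dbar 0.
  rewrite sigmoid0 -/dlt sigmoid_Deltabar subr0 addrAC subrr add0r.
  move=> /le_trans; apply; rewrite -mulrA ler_wpM2l //; first by lra.
  by rewrite ler_piMl //; lra.
have c0 : 0 <= mismatch th a / k by rewrite divr_ge0 ?mismatch_ge0 // ltW.
have c1 : mismatch th a / k <= 1 by rewrite ler_pdivrMr // mul1r mismatch_le.
rewrite mulrAC -mulrA; set c := mismatch th a / k in c0 c1 *.
rewrite -[in leRHS]sigmoid_Deltabar.
apply: le_trans (sigmoidB_ge D_gt1 (score_le th a)); rewrite sigmoid_Deltabar.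
have -> : Dbar - score th a = 2 * Dbar * c by rewrite scoreE /c; ring.
have z0 : 0 <= Dbar * c by rewrite mulr_ge0 // ltW.
have z1 : Dbar * c <= 1 / 99 by nra.
have -> : (dlt + Dlt) * (1 - sigmoid D (score th a)) * (2 * Dbar * c / (1 + 2 * Dbar * c))
  = (dlt + Dlt) * Dbar * c * (2 * (1 - sigmoid D (score th a)) / (1 + 2 * (Dbar * c))).
  by field; rewrite lt0r_neq0 //; lra.
have f1 : 1 <= 2 * (1 - sigmoid D (score th a)) / (1 + 2 * (Dbar * c)).
  by rewrite ler_pdivlMr; lra.
have f0 : Dlt * c <= (dlt + Dlt) * Dbar * c by rewrite ler_wpM2r.
apply: le_trans f0 _; rewrite ler_peMr //; do 2!(apply: mulr_ge0 => //); lra.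
Qed.

(** * Bellman inequalities and the optimal gain *)

Lemma bellman_gap (th : act d) (x : state) (a : act d) :
  reward R x a + bw * (Dlt / k) * ((~~ x)%:R * mismatch th a)
    + \sum_y trans D T th x a y * bias y <= J + bias x.
Proof.
have w0 := bw_gt0; have wE := bwE; rewrite big_bool !transE /bias /= mulr0 addr0.
case: x => /=; first by lra.
(* At [x0] the loss against [J = (dlt + Dlt) * bw] is [bw] times the shortfall in the probability of
   moving to [x1]. *)
have := ler_wpM2l (ltW w0) (mismatch_gap th a); lra.
Qed.

Lemma bellman_le (th : act d) (x : state) (a : act d) :
  reward R x a + \sum_y trans D T th x a y * bias y <= J + bias x.
Proof.
apply: le_trans (bellman_gap th x a); rewrite lerD2r lerDl.
apply: mulr_ge0; last by rewrite mulr_ge0 ?mismatch_ge0.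
apply: mulr_ge0; first exact: ltW bw_gt0.
by rewrite divr_ge0 // ltW ?Delta_gt0 ?dm1_gt0.
Qed.

(** Actions and parameters share one encoding, so [th] itself serves as the optimal action. *)
Lemma bellman_opt (th : act d) (x : state) :
  reward R x th + \sum_y trans D T th x th y * bias y = J + bias x.
Proof.
have wE := bwE; rewrite big_bool !transE /bias /= mulr0 addr0.
case: x => /=; first by lra.
have -> : score th th = Dbar.
  by rewrite scoreE /mismatch big1 ?mulr0 ?subr0 // => i _; rewrite eqxx.
by rewrite sigmoid_Deltabar; ring.
Qed.

Lemma vstar_le (th : act d) n x : vstar D T th n x <= n%:R * J + bias x.
Proof.
elim: n x => [|n IHn] x; first by rewrite /= mul0r add0r bias_ge0.
(* The maximum in [vstar] starts from 0, so the bound must be shown nonnegative as well. *)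
apply: bigmax_le => [|a _].
  by rewrite addr_ge0 ?bias_ge0 // mulr_ge0 ?gain_ge0.
have : \sum_y trans D T th x a y * vstar D T th n y <=
    \sum_y trans D T th x a y * (n%:R * J + bias y).
  by apply: ler_sum => y _; rewrite ler_wpM2l ?IHn // ltW ?trans_gt0.
under [X in _ <= X]eq_bigr do rewrite mulrDr.
rewrite big_split /= -mulr_suml (stochastic_trans th x a).2 mul1r -natr1.
have := bellman_le th x a; lra.
Qed.

(** Playing [th] throughout attains the gain; subtracting [bw] makes the base case true at [x1]. *)
Lemma vstar_ge (th : act d) n x : n%:R * J + bias x - bw <= vstar D T th n x.
Proof.
elim: n x => [|n IHn] x.
  by rewrite /= mul0r add0r /bias; have := bw_gt0; case: x => /=; lra.
apply: le_trans (le_bigmax _ _ th).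
have : \sum_y trans D T th x th y * (n%:R * J - bw + bias y) <=
    \sum_y trans D T th x th y * vstar D T th n y.
  apply: ler_sum => y _; rewrite ler_wpM2l ?(ltW (trans_gt0 _ _ _ _)) //.
  by have := IHn y; lra.
under [X in X <= _]eq_bigr do rewrite mulrDr.
rewrite big_split /= -mulr_suml (stochastic_trans th x th).2 mul1r -natr1.
have := bellman_opt th x; lra.
Qed.

Lemma JstarE (th : act d) : Jstar D T th = J.
Proof.
apply: cvg_lim; first exact: Rhausdorff.
apply: (@squeeze_cvgr _ _ _ _ (fun n => J - bw / n%:R) (fun=> J)).
- near=> n.
  have n0 : 0 < n%:R :> R by rewrite ltr0n; near: n; exact: nbhs_infty_gt.
  rewrite ler_pdivrMr // ler_pdivlMr // mulrBl divfK ?lt0r_neq0 //.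
  have := vstar_le th n x0; have := vstar_ge th n x0; rewrite /bias /=.
  by rewrite addr0 [J * _]mulrC => -> ->.
- suff : (J - bw / n%:R @[n --> \oo] --> J - bw * 0)%classic by rewrite mulr0 subr0.
  apply: cvgB; first exact: cvg_cst.
  apply: cvgM; first exact: cvg_cst.
  apply/gtr0_cvgV0; last exact: cvgr_idn.
  by near=> n; rewrite ltr0n; near: n; exact: nbhs_infty_gt.
- exact: cvg_cst.
Unshelve. all: by end_near.
Qed.

(** * Norms of the transition core and of the features *)

Lemma fnorm_thetabar (th : act d) : Ltheta D T th = 1 + Dbar.
Proof.
have k0 := dm1_gt0; have b0 := Deltabar_gt0; have b1 := onepDbar_gt0.
rewrite /Ltheta /fnorm /fdot /=.
transitivity (Num.sqrt ((1 + Dbar) ^+ 2)); last by rewrite sqrtr_sqr ger0_norm ?ltW.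
congr Num.sqrt.
transitivity (\sum_(i < d.-1) (alpha d D T ^+ 2)^-1 * (Dbar / k) ^+ 2
  + (beta d D T ^+ 2)^-1).
  congr (_ + _); last by rewrite -expr2 exprVn.
  apply: eq_bigr => i _; rewrite !mxE -exprVn /sgnb.
  by case: (th i); ring.
(* By the choice of [alpha] and [beta], the squared norm is [Dbar (1 + Dbar) + (1 + Dbar)], a
   perfect square. *)
rewrite sumr_const card_ord -mulr_natr dm1E alpha_sqr beta_sqr.
by field; rewrite !lt0r_neq0.
Qed.

Lemma Lphi_le : Lphi d D T <= 1 + ln (D - 1).
Proof.
have k0 := dm1_gt0; have b0 := Deltabar_gt0; have b1 := onepDbar_gt0.
have ln0 : 0 <= ln (D - 1) by rewrite ln_ge0 //; move: D_ge; lra.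
have B0 : 0 <= 1 + ln (D - 1) by lra.
have sqrt_le (v : feat R d) : fdot v v <= (1 + ln (D - 1)) ^+ 2 -> fnorm v <= 1 + ln (D - 1).
  by move=> le_v; rewrite /fnorm -(ger0_norm B0) -sqrtr_sqr ler_sqrt ?sqr_ge0.
have beta_le : (beta d D T * ln (D - 1)) ^+ 2 <= ln (D - 1) ^+ 2.
  rewrite exprMn beta_sqr ler_piMl ?sqr_ge0 // ler_pdivrMr //; lra.
have ln_le : ln (D - 1) ^+ 2 + 1 <= (1 + ln (D - 1)) ^+ 2 by nra.
apply: bigmax_le => // x _; apply: bigmax_le => // a _; apply: bigmax_le => // y _.
apply: sqrt_le; case: x y => [] [].
- apply: (@le_trans _ _ (ln (D - 1) ^+ 2)); last by lra.
  rewrite /fdot /= big1 ?add0r -?expr2 => [|i _]; last by rewrite mxE mul0r.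
  by rewrite /delta invrK.
- by rewrite [phi _ _ _ _ _]/= fdot0l sqr_ge0.
- by rewrite [phi _ _ _ _ _]/= fdot0l sqr_ge0.
- rewrite /fdot /= -expr2 /delta invrK; apply: le_trans ln_le; rewrite addrC lerD //.
  rewrite (eq_bigr (fun=> alpha d D T ^+ 2)) => [|i _]; last first.
    by rewrite !mxE /sgnb; case: (a i); ring.
  rewrite sumr_const card_ord -mulr_natr dm1E alpha_sqr.
  have -> : Dbar / (k * (1 + Dbar)) * k = Dbar / (1 + Dbar) by field; rewrite !lt0r_neq0.
  by rewrite ler_pdivrMr //; lra.
Qed.

(** * Effect of one parameter coordinate on the transition law *)

Lemma score_dist (th th' a : act d) : `|mismatch th a - mismatch th' a| <= 1 ->
  `|score th a - score th' a| <= 2 * Dbar / k.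
Proof.
move=> le1; rewrite !scoreE.
have c0 : 0 <= 2 * Dbar / k by rewrite divr_ge0 ?mulr_ge0 // ltW ?Deltabar_gt0 ?dm1_gt0.
have -> : Dbar - 2 * Dbar / k * mismatch th a - (Dbar - 2 * Dbar / k * mismatch th' a)
  = - (2 * Dbar / k * (mismatch th a - mismatch th' a)) by ring.
by rewrite normrN normrM (ger0_norm c0) ler_piMr.
Qed.

Lemma sigmoid_dist x y : x <= Dbar -> y <= Dbar ->
  `|sigmoid D x - sigmoid D y| <= (dlt + Dlt) * `|x - y|.
Proof.
have d0 := delta_gt0; have D0 := Delta_gt0.
wlog le_yx : x y / y <= x => [IH xb yb|xb _].
  have [/IH|/ltW/IH] := leP y x; first exact.
  by rewrite distrC [X in _ <= _ * X]distrC; apply.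
rewrite !ger0_norm ?subr_ge0 ?ler_sigmoid //.
apply: le_trans (sigmoidB_le D_gt1 x y) _; rewrite ler_wpM2r ?subr_ge0 //.
have q0 := sigmoid_gt0 D_gt1 x; have q1 := sigmoid_gt0 D_gt1 y.
have := ler_sigmoid D_gt1 xb; rewrite sigmoid_Deltabar.
by have := sigmoid_lt1 D_gt1 y; nra.
Qed.

(** The variance on the right is close to [dlt], while [T (Dlt / k)^2 <= dlt / 405]: as [Delta] is
    proportional to [k], the effect of one coordinate is free of the dimension. The factor 80 fits
    because [80 * 2.1^2 / 405 < 9/10]. *)
Lemma sigmoid_sqr_dist x y : - Dbar <= y -> x <= Dbar -> y <= Dbar ->
    `|x - y| <= 2 * Dbar / k ->
  80 * T%:R * (sigmoid D x - sigmoid D y) ^+ 2 <= sigmoid D y * (1 - sigmoid D y).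
Proof.
move=> yge xb yb xy; have d0 := delta_gt0; have D0 := Delta_gt0; have dD := Delta_le.
have d1 := delta_le; have k0 := dm1_gt0; have b0 := Deltabar_gt0; have b1 := Deltabar_le.
have T0 := horizon_gt0.
have dist : `|sigmoid D x - sigmoid D y| <= 21 / 10 * (Dlt / k).
  apply: le_trans (sigmoid_dist xb yb) _.
  apply: (@le_trans _ _ ((dlt + Dlt) * (2 * Dbar / k))); first by rewrite ler_wpM2l //; lra.
  rewrite [leLHS]mulrA [leRHS]mulrA ler_wpM2r ?invr_ge0 ?(ltW k0) //.
  have e := delta_Deltabar_le; have e2 := ler_wpM2r (ltW b0) dD. lra.
have sqr : (sigmoid D x - sigmoid D y) ^+ 2 <= (21 / 10) ^+ 2 * (Dlt / k) ^+ 2.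
  rewrite -exprMn -[leLHS]real_normK ?num_real // lerXn2r ?nnegrE ?normr_ge0 //.
  by rewrite mulr_ge0 // divr_ge0 // ltW.
have u2 : (Dlt / k) ^+ 2 * (405 * T%:R) <= dlt.
  rewrite expr_div_n mulrAC ler_pdivrMr ?exprn_gt0 //.
  have := ler_wpM2l (ltW d0) Delta_sqr_le.
  have -> : dlt * (Dlt ^+ 2 * (405 * (T%:R * D))) = Dlt ^+ 2 * (405 * T%:R) * (dlt * D) by ring.
  by rewrite deltaD mulr1.
have q0 : 98 / 99 * dlt <= sigmoid D y.
  apply: le_trans (ler_sigmoid D_gt1 yge).
  have := sigmoidB_le D_gt1 0 (- Dbar); rewrite sigmoid0 -/dlt opprK add0r.
  have m0 := sigmoid_gt0 D_gt1 (- Dbar); have m1 := sigmoid_lt1 D_gt1 (- Dbar).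
  have : dlt * (1 - sigmoid D (- Dbar)) * Dbar <= dlt * (1 / 99).
    rewrite -mulrA ler_wpM2l ?(ltW d0) //; apply: le_trans b1.
    by rewrite ler_piMl ?(ltW b0) //; lra.
  by lra.
have q1 : sigmoid D y <= dlt + Dlt by rewrite -sigmoid_Deltabar ler_sigmoid.
have lhs : 80 * T%:R * (sigmoid D x - sigmoid D y) ^+ 2 <= 9 / 10 * dlt.
  have := ler_wpM2l (ltW T0) sqr; lra.
apply: le_trans lhs _; nra.
Qed.

(** At [x1] the kernel does not depend on theta; at [x0] the laws are two-point, with chi-square
    divergence [(p - q)^2 / (q (1 - q))]. *)
Lemma chi2_trans_le (th th' a : act d) s : `|mismatch th a - mismatch th' a| <= 1 ->
  \sum_s' trans D T th s a s' ^+ 2 / trans D T th' s a s' <= 1 + (1 / 80) / T%:R.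
Proof.
move=> /score_dist dist; have T0 := horizon_gt0.
have d0 := delta_gt0; have d1 := delta_le; have r0 : 0 < 1 - dlt by lra.
rewrite big_bool !transE; case: s => /=.
  have -> : (1 - dlt) ^+ 2 / (1 - dlt) + dlt ^+ 2 / dlt = 1.
    by field; rewrite !lt0r_neq0.
  by rewrite lerDl !divr_ge0 ?ltW.
have := sigmoid_sqr_dist (score_ge th' a) (score_le th a) (score_le th' a) dist.
have := sigmoid_gt0 D_gt1 (score th' a); have := sigmoid_lt1 D_gt1 (score th' a).
move: (sigmoid D (score th a)) (sigmoid D (score th' a)) => p q q1 q0 le_pq.
have q1' : 0 < 1 - q by lra.
have -> : p ^+ 2 / q + (1 - p) ^+ 2 / (1 - q) = 1 + (p - q) ^+ 2 / (q * (1 - q)).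
  by field; rewrite !lt0r_neq0.
rewrite lerD2l ler_pdivrMr ?mulr_gt0 // mulrAC ler_pdivlMr //; lra.
Qed.

(** * Flipping one coordinate and averaging over all parameters *)

Definition flip (j : 'I_d.-1) (th : act d) : act d :=
  [ffun i => if i == j then ~~ th i else th i].

Lemma flipK j : involutive (flip j).
Proof. by move=> th; apply/ffunP => i; rewrite !ffunE; case: eqP => // _; rewrite negbK. Qed.

Lemma mismatch_flip j (th a : act d) : `|mismatch th a - mismatch (flip j th) a| <= 1.
Proof.
rewrite /mismatch (bigD1 j) //= [X in _ - X](bigD1 j) //= !ffunE eqxx.
rewrite (eq_bigr (fun i => (a i != flip j th i)%:R)) => [|i /negPf ij]; last first.
  by rewrite ffunE ij.
rewrite opprD addrACA subrr addr0.
by case: (a j); case: (th j); rewrite /= ?subr0 ?sub0r ?normrN ?normr1.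
Qed.

Variable alg : algorithm R d.
Hypothesis algP : is_algorithm alg.

Let alg_ge0 h s a : 0 <= alg h s a. Proof. exact: (algP h s).1. Qed.
Let alg_sum1 h s : \sum_a alg h s a = 1. Proof. exact: (algP h s).2. Qed.

Lemma exp_rewardE (th : act d) h s n :
  exp_reward D T th alg h s n = value alg (trans D T th) (@reward R d) h s n.
Proof.
elim: n h s => //= n IHn h s; apply: eq_bigr => a _.
by congr (_ * (_ + _)); apply: eq_bigr => s' _; rewrite IHn.
Qed.

(** Only steps at [x0] count, since at [x1] the action affects neither reward nor transition. *)
Definition errors (th : act d) (j : 'I_d.-1) : R :=
  value alg (trans D T th) (fun s a => (~~ s && (a j != th j))%:R) [::] x0 T.

(** This is [value_potential] for the reward augmented by the penalty of [bellman_gap], started at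
    [x0] where the bias is 0. *)
Lemma regret_ge (th : act d) :
  bw * (Dlt / k) * \sum_j errors th j <= expected_regret D T th alg.
Proof.
rewrite /expected_regret JstarE exp_rewardE lerBrDl /errors -value_sum -value_sub.
rewrite -[leRHS]addr0.
apply: (value_potential (b := bias) alg_ge0 alg_sum1 [::] x0 T (stochastic_trans th) bias_ge0).
move=> s a; apply: le_trans (bellman_gap th s a); rewrite le_eqVlt; apply/orP; left.
apply/eqP; congr (_ + _ * _ + _); rewrite /mismatch mulr_sumr.
by apply: eq_bigr => j _; rewrite -natrM mulnb.
Qed.

Lemma errors_flip_ge (th : act d) j :
  37 / 100 * T%:R <= errors th j + errors (flip j th) j.
Proof.
have T0 := horizon_gt0; have T_gt0 : (0 < T)%N by move: T0; rewrite ltr0n.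
(* A coordinate that is right for [th] is wrong for [flip j th]. *)
pose hit (s : state) (a : act d) : R := (~~ s && (a j == th j))%:R.
have -> : errors (flip j th) j = value alg (trans D T (flip j th)) hit [::] x0 T.
  apply: eq_value => s a; rewrite /hit ffunE eqxx.
  by case: (a j); case: (th j).
(* Errors and hits add up to the visits to [x0], whose indicator is [1 - reward]. *)
have visits : T%:R * (100 / 201) <=
    errors th j + value alg (trans D T th) hit [::] x0 T.
  rewrite -[value _ _ hit _ _ _]mul1r -value_sub.
  rewrite (@eq_value _ _ _ _ _ _ (fun s a => 1 + -1 * reward R s a)); last first.
    by move=> [] a; rewrite /hit /=; case: (a j == th j) => /=; ring.
  rewrite value_sub (value_cst alg_sum1 _ _ _ _ (stochastic_trans th)).
  have := value_potential alg_ge0 alg_sum1 [::] x0 T (stochastic_trans th) bias_ge0 (bellman_le th).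
  have := ler_wpM2l (ltW T0) bw_ge; rewrite /= -bwE; lra.
(* With [l = 10] the bound per step is [5 * (80/79 - 1) + 1/20 < 12/100], and
   [100/201 - 12/100 > 37/100]. *)
have chi : value alg (trans D T th) hit [::] x0 T
    - value alg (trans D T (flip j th)) hit [::] x0 T <= T%:R * (12 / 100).
  have c01 : 0 <= (1 / 80 : R) < 1 by lra.
  apply: le_trans (value_chi2 (C := 1 + (1 / 80) / T%:R) (l := 10) alg_ge0 alg_sum1
    [::] x0 T (stochastic_trans th) (stochastic_trans _) (@trans_gt0 _) _ _ _ _) _.
  - by move=> s a; rewrite ler0n lern1 leq_b1.
  - by [].
  - by rewrite lerDl !divr_ge0.
  - by move=> s a; apply: chi2_trans_le; exact: mismatch_flip.
  rewrite ler_wpM2l ?(ltW T0) //.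
  have := compound_le T_gt0 c01.
  have -> : (1 - 1 / 80 : R)^-1 = 80 / 79 by field.
  by move: ((1 + _) ^+ T) => P; lra.
move: visits chi; move: (errors th j) (value _ _ _ _ _ _) (value _ _ _ _ _ _) => e v v'.
lra.
Qed.

(** Since [flip j] permutes the parameters, the mean of [errors] over them is, for each coordinate,
    at least half of the bound in [errors_flip_ge]. *)
Lemma sum_errors_ge : exists th : act d, 185 / 1000 * T%:R * k <= \sum_j errors th j.
Proof.
apply: (exists_ge_mean [ffun=> true]).
rewrite exchange_big /= mulrCA mulrC -dm1E.
have avg j : #|{: act d}|%:R * (37 / 100 * T%:R) <= 2 * \sum_th errors th j.
  have -> : 2 * \sum_th errors th j = \sum_th (errors th j + errors (flip j th) j).
    have e := reindex_inj (inv_inj (@flipK j)) (P := xpredT) (F := errors^~ j).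
    by rewrite big_split /= -[X in _ = _ + X]e mulr_natl mulr2n.
  rewrite mulr_natl -sumr_const ler_sum // => th _; exact: errors_flip_ge.
have : \sum_(j < d.-1) #|{: act d}|%:R * (37 / 100 * T%:R) <=
    \sum_j 2 * \sum_th errors th j by apply: ler_sum.
rewrite -mulr_sumr sumr_const card_ord -mulr_natl; lra.
Qed.

Lemma regret_lower_bound : exists th : act d,
  1 / 2025 * d%:R * Num.sqrt (D * T%:R) <= expected_regret D T th alg.
Proof.
have [th le_th] := sum_errors_ge; exists th; apply: le_trans (regret_ge th).
have T0 := horizon_gt0; have k0 := dm1_gt0; have D0 := Delta_gt0; have w0 := bw_gt0.
have c0 : 0 <= bw * (Dlt / k) by rewrite mulr_ge0 ?(ltW w0) // divr_ge0 // ltW.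
apply: le_trans (ler_wpM2l c0 le_th).
have -> : bw * (Dlt / k) * (185 / 1000 * T%:R * k) = 185 / 1000 * T%:R * Dlt * bw.
  have wd0 : 0 < 2 * dlt + Dlt by rewrite -invr_gt0.
  by field; rewrite !lt0r_neq0.
have bwD : 100 / 201 * D <= bw.
  have := ler_wpM2r (ltW D_gt0) bw_ge.
  by rewrite [leRHS]mulrAC deltaD mul1r.
set S := Num.sqrt (D * T%:R).
have S2 : S ^+ 2 = D * T%:R by rewrite sqr_sqrtr // mulr_ge0 ?ltW.
have S0 : 0 <= S by exact: sqrtr_ge0.
have TD0 : 0 <= 185 / 1000 * T%:R * Dlt.
  by apply: mulr_ge0 (ltW D0); apply: mulr_ge0 (ltW T0); lra.
apply: le_trans (ler_wpM2l TD0 bwD).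
(* Thus [Dlt * D * T] is at least [k * S / 45]. As [d <= 2 k], it remains that
   [185/1000 * 100/201 / 45] exceeds [2/2025]. *)
have kS := ler_wpM2r S0 dm1_le_Delta; rewrite -/S in kS.
have dS : d%:R * S <= 2 * k * S.
  by rewrite ler_wpM2r //; have := dm1_ge1; rewrite /dm1; lra.
have : 45 * Dlt * S * S = 45 * Dlt * (D * T%:R) by rewrite -S2; ring.
have kS0 : 0 <= k * S by rewrite mulr_ge0 // ltW.
lra.
Qed.

End HardInstance.

Theorem theorem9 (R : realType) (d : nat) (D : R) (T : nat) :
  (2 <= d)%N -> 101 <= D -> 45 * (d%:R - 1) ^+ 2 * D <= T%:R ->
  forall alg : algorithm R d, is_algorithm alg ->
  exists th : act d,
    @Ltheta R d D T th <= 100 / 99 /\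
    @Lphi R d D T <= 1 + ln (D - 1) /\
    1 / 2025 * d%:R * Num.sqrt (D * T%:R) <= @expected_regret R d D T th alg.
Proof.
move=> d_ge2 D_ge T_ge alg algP.
have [th le_th] := regret_lower_bound d_ge2 D_ge T_ge algP; exists th; split.
  rewrite fnorm_thetabar //; have := Deltabar_le d_ge2 D_ge T_ge; lra.
by split=> //; exact: Lphi_le.
Qed.
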